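(* Let $\hat\zeta_{n,\sigma}$ be the estimator of $\zeta_\sigma(\mathrm P)$ computed from the augmented data $\{(\mathbf X_i,\mathbf X_i',\mathbf Y_i,\mathbf Z_i)\}_{i=1}^n$, and let $$p_n=\frac1{2^n}\sum_{\pi\in\{0,1\}^n}\mathrm I\big[\hat\zeta_{n,\sigma}(\pi)\ge\hat\zeta_{n,\sigma}\big]$$ be the conditional $p$-value. Let $0<\alpha<1$. Then under $H_0$ (that is, if $\mathbf X$ and $\mathbf Y$ are conditionally independent given $\mathbf Z$), $\mathbb P\{p_n<\alpha\}\le\alpha$, irrespective of $n$ and of the dimension $d$.
   Context: Fix $\sigma^2>0$ and let $K(\mathbf x,\mathbf y)=\exp\{-\sigma^2\|\mathbf x-\mathbf y\|^2/2\}$ on $\mathbb R^d$, $d=d_X+d_Y+d_Z$. $\{(\mathbf X_i,\mathbf Y_i,\mathbf Z_i)\}_{i=1}^n$ ($n\ge2$) is an i.i.d. sample from $\mathrm P$, the law of $(\mathbf X,\mathbf Y,\mathbf Z)$; the conditional distribution $\mathrm P_{\mathbf X\mid\mathbf Z}$ is known and, given the sample, the $\mathbf X_i'$ are drawn independently with $\mathbf X_i'\sim\mathrm P_{\mathbf X\mid\mathbf Z_i}$ (so $\mathbf X_i'$ is conditionally independent of $(\mathbf X_i,\mathbf Y_i)$ given $\mathbf Z_i$). With $\mathbf V_i=(\mathbf X_i,\mathbf Y_i,\mathbf Z_i)$ and $\mathbf V_i'=(\mathbf X_i',\mathbf Y_i,\mathbf Z_i)$, $$\hat\zeta_{n,\sigma}=\binom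 n2^{-1}\sum_{1\le i<j\le n}\big\{K(\mathbf V_i,\mathbf V_j)+K(\mathbf V_i',\mathbf V_j')-K(\mathbf V_i,\mathbf V_j')-K(\mathbf V_i',\mathbf V_j)\big\},$$ an estimator of $\zeta_\sigma(\mathrm P)=\mathbb E[K(\mathbf V_1,\mathbf V_2)]+\mathbb E[K(\mathbf V_1',\mathbf V_2')]-2\mathbb E[K(\mathbf V_1,\mathbf V_2')]$. For $\pi=(\pi(1),\dots,\pi(n))\in\{0,1\}^n$, $\hat\zeta_{n,\sigma}(\pi)$ is the same statistic computed with $(\mathbf X_i,\mathbf X_i')$ replaced by $(\mathbf U_i,\mathbf U_i')$, where $\mathbf U_i=\pi(i)\mathbf X_i+(1-\pi(i))\mathbf X_i'$ and $\mathbf U_i'=(1-\pi(i))\mathbf X_i+\pi(i)\mathbf X_i'$. *)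

(* Defs.v *)
From HB Require Import structures.
From mathcomp Require Import all_boot all_order all_algebra.
From mathcomp Require Import all_classical all_reals all_analysis.

Set Implicit Arguments.
Unset Strict Implicit.
Unset Printing Implicit Defensive.

Import Order.TTheory GRing.Theory Num.Theory.
Import numFieldNormedType.Exports.

Local Open Scope classical_set_scope.
Local Open Scope ring_scope.

(* Vectors of R^d are d.-tuple R, which carries the product sigma-algebra of
   the Borel sigma-algebra of R. *)

(* The norm is Euclidean; it is written out since the library norm on
   finite-dimensional vectors is the sup norm. *)
Definition sqnorm_dist (R : realType) (d : nat) (u v : d.-tuple R) : R :=
  \sum_(k < d) (tnth u k - tnth v k) ^+ 2.

Definition gauss_kernel (R : realType) (sigma : R) (d : nat)
    (u v : d.-tuple R) : R :=
  expR (- (sigma ^+ 2 * sqnorm_dist u v / 2)).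

Definition zeta_hat (R : realType) (sigma : R) (dX dY dZ n : nat)
    (x x' : 'I_n -> dX.-tuple R) (y : 'I_n -> dY.-tuple R)
    (z : 'I_n -> dZ.-tuple R) : R :=
  let v i := [tuple of x i ++ y i ++ z i] in
  let v' i := [tuple of x' i ++ y i ++ z i] in
  let K u w := gauss_kernel sigma u w in
  ('C(n, 2)%:R)^-1 *
  \sum_(i < n) \sum_(j < n | (i < j)%N)
    (K (v i) (v j) + K (v' i) (v' j) - K (v i) (v' j) - K (v' i) (v j)).

Definition mix (R : realType) (d : nat) (b : bool) (u v : d.-tuple R) :
    d.-tuple R :=
  [tuple b%:R * tnth u k + (1 - b%:R) * tnth v k | k < d].

(* An element pi of {0,1}^n is a finite function 'I_n -> bool, true being 1. *)
Definition zeta_hat_swap (R : realType) (sigma : R) (dX dY dZ n : nat)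
    (x x' : 'I_n -> dX.-tuple R) (y : 'I_n -> dY.-tuple R)
    (z : 'I_n -> dZ.-tuple R) (pi : {ffun 'I_n -> bool}) : R :=
  zeta_hat sigma (fun i => mix (pi i) (x i) (x' i))
    (fun i => mix (pi i) (x' i) (x i)) y z.

Definition p_value (R : realType) (sigma : R) (dX dY dZ n : nat)
    (x x' : 'I_n -> dX.-tuple R) (y : 'I_n -> dY.-tuple R)
    (z : 'I_n -> dZ.-tuple R) : R :=
  (2 ^+ n)^-1 * \sum_(pi : {ffun 'I_n -> bool})
    (zeta_hat sigma x x' y z <= zeta_hat_swap sigma x x' y z pi)%R%:R.

Section conditional_probability.
Context d dX dY dZ (T : measurableType d) (TX : measurableType dX)
  (TY : measurableType dY) (TZ : measurableType dZ) (R : realType).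

(* f is a version of the conditional probability z |-> P(E | Z = z). *)
Definition cond_prob_version (P : probability T R) (Z : T -> TZ) (E : set T)
    (f : TZ -> R) : Prop :=
  measurable_fun setT f /\
  forall C : set TZ, measurable C ->
    (\int[P]_(w in Z @^-1` C) (f (Z w))%:E = P (E `&` Z @^-1` C))%E.

(* kappa is a regular conditional distribution of X given Z. *)
Definition cond_distribution (P : probability T R) (X : T -> TX) (Z : T -> TZ)
    (kappa : R.-pker TZ ~> TX) : Prop :=
  forall A : set TX, measurable A ->
    cond_prob_version P Z (X @^-1` A) (fun z => fine (kappa z A)).

(* P(X in A, Y in B | Z) = P(X in A | Z) P(Y in B | Z) almost surely, for all
   measurable A and B; conditional probabilities being unique up to null sets,
   the identity is required of all their versions. *)
Definition cond_independent (P : probability T R) (X : T -> TX) (Y : T -> TY)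
    (Z : T -> TZ) : Prop :=
  forall (A : set TX) (B : set TY), measurable A -> measurable B ->
  forall f g h : TZ -> R,
    cond_prob_version P Z (X @^-1` A) f ->
    cond_prob_version P Z (Y @^-1` B) g ->
    cond_prob_version P Z (X @^-1` A `&` Y @^-1` B) h ->
    {ae P, forall w, h (Z w) = f (Z w) * g (Z w)}.

End conditional_probability.

Section sampling.
Context d dS (T : measurableType d) (S : measurableType dS) (R : realType).

Definition mutually_independent (P : probability T R) (n : nat)
    (V : 'I_n -> T -> S) : Prop :=
  forall (J : {set 'I_n}) (A : 'I_n -> set S), (forall i, measurable (A i)) ->
    (P (\bigcap_(i in [set` J]) (V i @^-1` A i)) =
     \prod_(i in J) P (V i @^-1` A i))%E.

(* The laws are compared on measurable sets only, the values of a measure on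
   other sets being irrelevant. *)
Definition same_law d0 (T0 : measurableType d0) (P : probability T R)
    (V : T -> S) (P0 : probability T0 R) (V0 : T0 -> S) : Prop :=
  forall A : set S, measurable A -> P (V @^-1` A) = P0 (V0 @^-1` A).

Definition iid_sample d0 (T0 : measurableType d0) (P : probability T R)
    (n : nat) (V : 'I_n -> T -> S) (P0 : probability T0 R) (V0 : T0 -> S) :
    Prop :=
  mutually_independent P V /\ forall i, same_law P (V i) P0 V0.

(* Conditionally on the sigma-algebra generated by V_1, ..., V_n, the W_i are
   independent and W_i has law kappa (Z_i). *)
Definition drawn_given_sample dX dZ (TX : measurableType dX)
    (TZ : measurableType dZ) (P : probability T R) (n : nat)
    (V : 'I_n -> T -> S) (Z : 'I_n -> T -> TZ) (kappa : R.-pker TZ ~> TX)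
    (W : 'I_n -> T -> TX) : Prop :=
  forall E : set T, g_sigma_preimage V E ->
  forall A : 'I_n -> set TX, (forall i, measurable (A i)) ->
    (P (E `&` \bigcap_i (W i @^-1` A i)) =
     \int[P]_(w in E) \prod_(i < n) kappa (Z i w) (A i))%E.

End sampling.

(* Main.v *)
From HB Require Import structures.
Require Import Defs.
From mathcomp Require Import all_boot all_order all_algebra.
From mathcomp Require Import all_classical all_reals all_analysis.
From mathcomp Require Import measurable_realfun.
Import Order.TTheory GRing.Theory Num.Theory.
Import numFieldNormedType.Exports.
Local Open Scope classical_set_scope.
Local Open Scope ring_scope.

Set Implicit Arguments.
Unset Strict Implicit.
Unset Printing Implicit Defensive.

(** The test is a randomization test for the group {0,1}^n, which acts on the
augmented data (X_i, X'_i, Y_i, Z_i) by exchanging X_i and X'_i in a chosen set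
of positions, so two facts suffice.

Under the null hypothesis the law of the data is invariant under this group.
Given Z_i, the variable X'_i has law kappa Z_i by construction and is
independent of (X_i, Y_i); conditional independence says that X_i too has law kappa Z_i
given (Y_i, Z_i). Hence
  P(X_i in A, X'_i in A', Y_i in B, Z_i in C)
    = E[1_B(Y_i) 1_C(Z_i) kappa Z_i A * kappa Z_i A'],
which is symmetric in A and A' (integral_cell_weightC). The triples being
independent, the probability of a product of such cells is the product of
these symmetric numbers (prob_data_box); cells form a pi-system, which gives
the invariance of the whole law (data_swap_invariant).

Invariance alone makes the p-value superuniform. For a fixed data set,
consider the 2^n p-values of its orbit: at most a fraction alpha of them can
be below alpha, because the one with the smallest statistic among those
counts all the others in its own rank (sum_rank_lt). By invariance
P(p_n < alpha) is the expectation of that fraction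
(randomization_p_value_superuniform).

The tool behind every computation of integrals is eq_ge0_integral_weight:
weighted averages that agree on the indicators of a variable agree on all its
nonnegative measurable functions. It turns products of conditional
probabilities into integrals, and independence of events into multiplicativity
of expectations. *)

(** * Weighted integrals of functions of a random variable *)

Section weighted_integrals.
Local Open Scope ereal_scope.
Import HBNNSimple.

(** The right-hand side involves the weight G only through its integrals over
the events that V belongs to A, which is what makes two weights comparable. *)
Lemma ge0_integral_weight d dS (T : measurableType d)
    (S : measurableType dS) (R : realType)
    (mu : {measure set T -> \bar R}) (V : T -> S)
    (G : T -> \bar R) (f : S -> \bar R) (mf : measurable_fun [set: S] f) :
  measurable_fun setT V -> measurable_fun setT G ->
  (forall w, 0 <= G w) -> (forall w, G w \is a fin_num) ->
  (forall x, 0 <= f x) ->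
  let h := nnsfun_approx measurableT mf in
  \int[mu]_w (G w * f (V w)) =
  limn (fun n => \sum_(r \in range (h n))
    r%:E * \int[mu]_(w in V @^-1` (h n @^-1` [set r])) G w).
Proof.
move=> mV mG G0 Gfin f0 h.
have mVI A : measurable A -> measurable (V @^-1` A).
  by move=> mA; rewrite -[X in measurable X]setTI; exact: mV.
have h_ge0 n x : 0 <= (h n x)%:E by rewrite lee_fin.
have -> : \int[mu]_w (G w * f (V w)) =
    limn (fun n => \int[mu]_w (G w * (h n (V w))%:E)).
  rewrite -monotone_convergence//.
  - apply: eq_integral => w _; apply/esym/cvg_lim => //.
    by apply: cvgeZl => //; exact: cvg_nnsfun_approx.
  - move=> n; apply: emeasurable_funM => //; apply/measurable_EFinP.
    by apply: measurableT_comp => //; exact/measurable_funP.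
  - by move=> n w _; rewrite mule_ge0.
  - move=> w _ a b ab; rewrite lee_wpmul2l// lee_fin.
    exact/lefP/nd_nnsfun_approx.
congr (limn _); apply/funext => n.
under eq_integral => w _.
  rewrite fimfunE -fsumEFin// ge0_mule_fsumr; last first.
    by move=> r; rewrite EFinM nnfun_muleindic_ge0.
  over.
have rI0 (r : R) x : 0 <= (r * \1_(h n @^-1` [set r]) x)%:E.
  by rewrite EFinM nnfun_muleindic_ge0.
rewrite ge0_integral_fsum//; last 2 first.
- move=> r; apply: emeasurable_funM => //; apply/measurable_EFinP.
  apply: measurable_funM => //; apply: measurableT_comp => //.
- by move=> r w _; rewrite mule_ge0.
apply: eq_fsbigr => r /[!inE] -[x _ <-].
rewrite [in RHS]integral_mkcond epatch_indic.
rewrite -ge0_integralZl//.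
- by apply: eq_integral => w _ /=; rewrite EFinM muleCA.
- apply: emeasurable_funM => //; apply/measurable_EFinP.
  exact/measurable_indic/mVI.
- by move=> w _ /=; rewrite mule_ge0// lee_fin.
- exact: h_ge0.
Qed.

(** Knowing E[G 1_A(V)] for all A determines E[G f(V)]: this replaces, for two
different probability spaces at once, the change of variables along V for the
measure of density G. The weights are finite so that multiplication by them
commutes with monotone limits. *)
Lemma eq_ge0_integral_weight d d' dS (T : measurableType d)
    (T' : measurableType d') (S : measurableType dS) (R : realType)
    (mu : {measure set T -> \bar R}) (mu' : {measure set T' -> \bar R})
    (V : T -> S) (V' : T' -> S) (G : T -> \bar R) (G' : T' -> \bar R)
    (f : S -> \bar R) :
  measurable_fun setT V -> measurable_fun setT V' ->
  measurable_fun setT G -> measurable_fun setT G' ->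
  (forall w, (0 <= G w)%E) -> (forall w, G w \is a fin_num) ->
  (forall w, (0 <= G' w)%E) -> (forall w, G' w \is a fin_num) ->
  (forall A, measurable A ->
    \int[mu]_(w in V @^-1` A) G w = \int[mu']_(w in V' @^-1` A) G' w)%E ->
  measurable_fun setT f -> (forall x, (0 <= f x)%E) ->
  (\int[mu]_w (G w * f (V w)) = \int[mu']_w (G' w * f (V' w)))%E.
Proof.
move=> mV mV' mG mG' G0 Gfin G'0 G'fin eqA mf f0.
rewrite (ge0_integral_weight mu mf mV mG)//.
rewrite (ge0_integral_weight mu' mf mV' mG')//.
congr (limn _); apply/funext => n.
by apply: eq_fsbigr => r _; rewrite eqA.
Qed.

End weighted_integrals.

(** * Expectations of products of independent variables *)

Section independence.
Context d dS (T : measurableType d) (S : measurableType dS) (R : realType).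
Variables (P : probability T R) (n : nat) (V : 'I_n -> T -> S).
Hypothesis mV : forall i, measurable_fun setT (V i).
Local Open Scope ereal_scope.

Lemma integral_weight_indic (mu : {measure set T -> \bar R}) (U : T -> S)
    (G : T -> \bar R) (A : set S) :
  \int[mu]_(w in U @^-1` A) G w = \int[mu]_w (G w * (\1_A (U w))%:E).
Proof. by rewrite integral_mkcond epatch_indic. Qed.

Lemma prod_unit_fin_num (I : finType) (Q : pred I) (x : I -> \bar R) :
  (forall i, 0 <= x i <= 1) ->
  0 <= \prod_(i | Q i) x i /\ \prod_(i | Q i) x i \is a fin_num.
Proof.
move=> x01; split; first by apply: prode_ge0 => i _; case/andP: (x01 i).
apply: prode_fin_num => i _; have /andP[x0 x1] := x01 i.
by rewrite ge0_fin_numE// (le_lt_trans x1)// ltry.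
Qed.

Lemma emeasurable_prod (I : finType) (Q : pred I) (g : I -> T -> \bar R) :
  (forall i, measurable_fun [set: T] (g i)) ->
  measurable_fun [set: T] (fun w => \prod_(i | Q i) g i w).
Proof.
move=> mg.
have -> : (fun w => \prod_(i | Q i) g i w) =
    \big[(fun a b w => a w * b w)/cst 1]_(i | Q i) g i.
  by apply/funext => w; elim/big_rec2: _ => // i a b _ ->.
by apply: (big_ind (measurable_fun [set: T])) => // *; exact: emeasurable_funM.
Qed.

(** Independence is the case where all the f i are indicators. Indicators are
replaced by general functions one coordinate at a time: with the other factors
put into the weight G, the integrals of G over the events of V j are known by
the previous step, and eq_ge0_integral_weight passes from indicators to f j.
The bound f i <= 1 keeps the constant E[G] finite. *)
Lemma independent_integral_prod (f : 'I_n -> S -> \bar R) :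
  mutually_independent P V ->
  (forall i, measurable_fun [set: S] (f i)) ->
  (forall i x, 0 <= f i x <= 1) ->
  \int[P]_w (\prod_i f i (V i w)) = \prod_i \int[P]_w f i (V i w).
Proof.
move=> indV.
(* k counts the coordinates already carrying a general function. *)
suff IH k : forall f : 'I_n -> S -> \bar R,
    (forall i, measurable_fun [set: S] (f i)) ->
    (forall i x, 0 <= f i x <= 1) ->
    (forall i : 'I_n, (k <= i)%N ->
       exists2 A, measurable A & f i = EFin \o \1_A) ->
    \int[P]_w (\prod_i f i (V i w)) = \prod_i \int[P]_w f i (V i w).
  by move=> mf f01; apply: (IH n) => // i; rewrite leqNgt ltn_ord.
have mVI i A : measurable A -> measurable (V i @^-1` A).
  by move=> mA; rewrite -[X in measurable X]setTI; exact: mV.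
elim: k => [|k IH] {}f mf f01 fk.
  have /choice[A Af] : forall i : 'I_n, exists A,
      measurable A /\ f i = EFin \o \1_A.
    by move=> i; have [//|A mA fA] := fk i; exists A.
  have := indV [set: 'I_n]%SET A (fun i => (Af i).1).
  transitivity (P (\bigcap_(i in [set` [set: 'I_n]%SET]) V i @^-1` A i)).
    rewrite -(setIT (\bigcap_(i in _) _)) -integral_indic//; last first.
      apply: fin_bigcap_measurable => // i _; exact: mVI (Af i).1.
    apply: eq_integral => w _.
    have [wA|wA] := pselect (forall i, A i (V i w)).
      rewrite indicE mem_set; last by move=> i _; exact: wA.
      by rewrite big1// => i _; rewrite (Af i).2 /= indicE mem_set.
    rewrite indicE memNset; last first.
      by move=> h; apply: wA => i; apply: h; rewrite /= inE.
    have [i iA] : exists i, ~ A i (V i w) by apply/existsNP.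
    by rewrite (bigD1 i)//= (Af i).2 /= indicE memNset// mul0e.
  rewrite H; apply: eq_big => [i|i _]; first by rewrite inE.
  rewrite -[V i @^-1` A i]setIT -integral_indic//; last exact: mVI (Af i).1.
  by apply: eq_integral => w _; rewrite (Af i).2.
have [nk|kn] := leqP n k.
  by apply: IH => // i; rewrite leqNgt (leq_trans (ltn_ord i)).
pose j := Ordinal kn.
pose G w := \prod_(i | i != j) f i (V i w).
pose c := \prod_(i | i != j) \int[P]_w f i (V i w).
have [|c0 cfin] := @prod_unit_fin_num _ (fun i => i != j)
    (fun i => \int[P]_w f i (V i w)).
- move=> i; rewrite integral_ge0/=; last first.
    by move=> w _; case/andP: (f01 i (V i w)).
  rewrite -(@probability_setT _ _ _ P) -[leRHS]mul1e -integral_cst//.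
  apply: ge0_le_integral => //.
  + by move=> w _; case/andP: (f01 i (V i w)).
  + exact: measurableT_comp.
  + by move=> w _; case/andP: (f01 i (V i w)).
have G0fin w : 0 <= G w /\ G w \is a fin_num by exact: prod_unit_fin_num.
transitivity (\int[P]_w (G w * f j (V j w))).
  by apply: eq_integral => w _; rewrite (bigD1 j)//= muleC.
rewrite (@eq_ge0_integral_weight _ _ _ _ _ _ _ P P (V j) (V j) G (cst c))//.
- rewrite ge0_integralZl//.
    by rewrite [RHS](bigD1 j)//= muleC.
  + exact: measurableT_comp.
  + by move=> w _; case/andP: (f01 j (V j w)).
- by apply: emeasurable_prod => i; exact: measurableT_comp.
- by move=> w; case: (G0fin w).
- by move=> w; case: (G0fin w).
- move=> A mA; rewrite integral_cst; last exact: mVI.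
  rewrite integral_weight_indic.
  pose f' i := if i == j then EFin \o \1_A else f i.
  have f'j : f' j = EFin \o \1_A by rewrite /f' eqxx.
  have f'N i : i != j -> f' i = f i by rewrite /f' => /negbTE ->.
  transitivity (\int[P]_w (\prod_i f' i (V i w))).
    apply: eq_integral => w _; rewrite [RHS](bigD1 j)//= f'j muleC.
    by congr (_ * _); apply: eq_bigr => i /f'N ->.
  rewrite IH.
  + rewrite (bigD1 j)//= f'j muleC; congr (_ * _).
      by apply: eq_bigr => i /f'N ->.
    by rewrite -[V j @^-1` A]setIT -integral_indic//; exact: mVI.
  + move=> i; have [->|/f'N -> //] := eqVneq i j.
    by rewrite f'j; apply/measurable_EFinP; exact: measurable_indic.
  + move=> i x; have [->|/f'N -> //] := eqVneq i j.
    by rewrite f'j /= !lee_fin indicE; case: (_ \in _); rewrite ?lexx ?ler01.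
  + move=> i ki; have [->|ij] := eqVneq i j; first by exists A.
    rewrite f'N//; apply: fk; rewrite ltn_neqAle ki andbT.
    by apply: contra ij => /eqP kE; apply/eqP/val_inj.
- by move=> x; case/andP: (f01 j x).
Qed.
End independence.

(** * Symmetry of one observation under conditional independence *)

Section conditional_exchangeability.
Context d dX dY dZ (T : measurableType d) (TX : measurableType dX)
  (TY : measurableType dY) (TZ : measurableType dZ) (R : realType).
Variable P : probability T R.
Local Open Scope ereal_scope.

(** By Radon-Nikodym. Conditional independence is a statement about all
versions of conditional probabilities, so it yields information only once
versions are known to exist; kappa provides one for X, but nothing provides
those for Y and for the pair (X, Y). *)
Lemma cond_prob_version_exists (Z : {RV P >-> TZ}) (E : set T) :
  measurable E ->
  exists2 g : TZ -> R, cond_prob_version P Z E g & forall z, (0 <= g z)%R.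
Proof.
move=> mE.
have mZ : measurable_fun [set: T] Z by exact: measurable_funP.
have mZI C : measurable C -> measurable (Z @^-1` C).
  by move=> mC; rewrite -[X in measurable X]setTI; exact: mZ.
have [nu nuE] : exists nu : {finite_measure set TZ -> \bar R},
    forall C, nu C = P (E `&` Z @^-1` C).
  pose push : {measure set TZ -> \bar R} := pushforward (mrestr P mE) Z.
  pose nu := push mZ.
  have nuE C : nu C = P (E `&` Z @^-1` C) by rewrite setIC.
  have nufin : fin_num_fun nu.
    move=> C mC; rewrite nuE fin_num_measure//.
    by apply: measurableI => //; exact: mZI.
  have nusigma : sigma_finite [set: TZ] nu.
    by apply: fin_num_fun_sigma_finite; rewrite ?measure0.
  by exists (HB.pack_for (FiniteMeasure.type TZ R) (Measure.sort nu)
    (isFinite.Build _ _ _ _ nufin)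
    (isSFinite.Build _ _ _ _ (sfinite_measure_sigma_finite nusigma))
    (isSigmaFinite.Build _ _ _ _ nusigma)).
have numu : nu `<< distribution P Z.
  apply/null_content_dominatesP => C mC PC0.
  apply/eqP; rewrite eq_le measure_ge0 andbT -PC0 /= /mrestr.
  have mZC := mZI C mC.
  rewrite nuE; apply: (@le_measure _ _ _ P); rewrite ?inE//.
  exact: measurableI.
pose f := Radon_Nikodym_SigmaFinite.f nu (distribution P Z).
have f0 z : 0 <= f z by exact: Radon_Nikodym_SigmaFinite.f_ge0.
have mf : measurable_fun [set: TZ] f.
  exact: measurable_int (Radon_Nikodym_SigmaFinite.f_integrable numu).
exists (fine \o f); last by move=> z; rewrite fine_ge0.
split; first by apply: measurableT_comp.
move=> C mC.
rewrite -nuE.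
rewrite (Radon_Nikodym_SigmaFinite.f_integral numu mC).
rewrite ge0_integral_pushforward//.
- apply: eq_integral => w _ /=; rewrite fineK//.
  exact: Radon_Nikodym_SigmaFinite.f_fin_num.
- exact: measurable_funTS mf.
Qed.

Variables (X : {RV P >-> TX}) (Y : {RV P >-> TY}) (Z : {RV P >-> TZ}).
Variable kappa : R.-pker TZ ~> TX.
Hypothesis hkappa : cond_distribution P X Z kappa.
Hypothesis hind : cond_independent P X Y Z.

Let mX : measurable_fun [set: T] X. Proof. exact: measurable_funP. Qed.
Let mY : measurable_fun [set: T] Y. Proof. exact: measurable_funP. Qed.
Let mZ : measurable_fun [set: T] Z. Proof. exact: measurable_funP. Qed.

Lemma pker01 z A : measurable A -> 0 <= kappa z A <= 1.
Proof.
move=> mA; rewrite measure_ge0/= -(prob_kernel (s := kappa) z).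
by apply: le_measure => //; rewrite inE.
Qed.

Lemma pker_fin_num z A : measurable A -> kappa z A \is a fin_num.
Proof.
move=> /(pker01 z)/andP[k0 k1].
by rewrite ge0_fin_numE// (le_lt_trans k1)// ltry.
Qed.

(** Given (Y, Z), the law of X is kappa Z: conditioning further on Y does not
change the conditional law of X given Z. *)
Lemma integral_cond_independent A B C :
  measurable A -> measurable B -> measurable C ->
  \int[P]_(w in Z @^-1` C) ((\1_A (X w))%:E * (\1_B (Y w))%:E) =
  \int[P]_(w in Z @^-1` C) ((\1_B (Y w))%:E * kappa (Z w) A).
Proof.
move=> mA mB mC.
have mpre d1 (U : measurableType d1) (V : T -> U) D :
    measurable_fun [set: T] V -> measurable D -> measurable (V @^-1` D).
  by move=> mV mD; rewrite -[X in measurable X]setTI; exact: mV.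
have mXA : measurable (X @^-1` A) by exact: mpre.
have mYB : measurable (Y @^-1` B) by exact: mpre.
have mZC D : measurable D -> measurable (Z @^-1` D) by exact: mpre.
have [g gP g0] := cond_prob_version_exists Z mYB.
have [h hP _] := cond_prob_version_exists Z (measurableI _ _ mXA mYB).
have fP := hkappa mA.
have hfg := hind mA mB fP gP hP.
have mgZ : measurable_fun [set: T] (fun w => (g (Z w))%:E).
  by apply/measurable_EFinP; apply: measurableT_comp => //; exact: gP.1.
have mkA : measurable_fun [set: TZ] (fun z => kappa z A).
  exact: measurable_kernel.
transitivity (\int[P]_(w in Z @^-1` C) (h (Z w))%:E).
  rewrite hP.2// -integral_indic//; last exact: measurableI.
    by apply: eq_integral => w _; rewrite indicI.
  exact: mZC.
transitivity (\int[P]_(w in Z @^-1` C) ((g (Z w))%:E * kappa (Z w) A)).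
  apply: ae_eq_integral => //.
  - exact: mZC.
  - apply/measurable_EFinP; apply: measurable_funTS.
    by apply: measurableT_comp => //; exact: hP.1.
  - apply: measurable_funTS; apply: emeasurable_funM => //.
    exact: measurableT_comp mkA mZ.
  - apply: filterS hfg => w /= -> _.
    by rewrite EFinM fineK ?pker_fin_num// muleC.
(* It remains to replace the version g(Z) of P(Y in B | Z) by 1_B(Y) against a
   function of Z, which is the defining property of g beyond indicators. *)
rewrite integral_weight_indic [RHS]integral_weight_indic.
under eq_integral do rewrite -muleA.
under [RHS]eq_integral do rewrite -muleA.
apply: (eq_ge0_integral_weight (f := fun z => kappa z A * (\1_C z)%:E)) => //.
- by apply/measurable_EFinP; apply: measurableT_comp.
- by move=> w; rewrite lee_fin.
- move=> D mD; rewrite gP.2// -integral_indic//; exact: mZC.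
- apply: emeasurable_funM => //; apply/measurable_EFinP.
  exact: measurable_indic.
Qed.

(** The conditional probability, given v = (X, Y, Z), of the event that
X in A, X' in A', Y in B and Z in C, where X' is drawn from kappa Z. *)
Definition cell_weight (A A' : set TX) (B : set TY) (C : set TZ)
    (v : TX * TY * TZ) : \bar R :=
  kappa v.2 A' * (\1_(A `*` B `*` C) v)%:E.

Lemma cell_weightE A A' B C x y z : cell_weight A A' B C (x, y, z) =
  (\1_A x)%:E * (\1_B y)%:E * (kappa z A' * (\1_C z)%:E).
Proof.
rewrite /cell_weight/= muleCA; congr (_ * _).
by rewrite -!EFinM !indicE !in_setX/= -!natrM !mulnb.
Qed.

(** Integrating X out as well puts kappa Z A in the place of 1_A(X), after
which A and A' play the same role. *)
Lemma integral_cell_weightC A A' B C :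
  measurable A -> measurable A' -> measurable B -> measurable C ->
  \int[P]_w cell_weight A A' B C (X w, Y w, Z w) =
  \int[P]_w cell_weight A' A B C (X w, Y w, Z w).
Proof.
move=> mA mA' mB mC.
have half A1 A2 : measurable A1 -> measurable A2 ->
    \int[P]_w cell_weight A1 A2 B C (X w, Y w, Z w) =
    \int[P]_w ((\1_B (Y w))%:E * (kappa (Z w) A1 * kappa (Z w) A2) *
               (\1_C (Z w))%:E).
  move=> mA1 mA2.
  have mk (D : set TX) : measurable D ->
      measurable_fun [set: TZ] (fun z => kappa z D).
    by move=> mD; exact: measurable_kernel.
  have mi d1 (U : measurableType d1) (V : T -> U) (D : set U) :
      measurable_fun [set: T] V -> measurable D ->
      measurable_fun [set: T] (fun w => (\1_D (V w))%:E : \bar R).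
    move=> mV mD; apply/measurable_EFinP; apply: measurableT_comp => //.
  transitivity (\int[P]_w ((\1_A1 (X w))%:E * (\1_B (Y w))%:E *
      (kappa (Z w) A2 * (\1_C (Z w))%:E))).
    by apply: eq_integral => w _; rewrite cell_weightE.
  rewrite (@eq_ge0_integral_weight _ _ _ _ _ _ _ P P Z Z _
    (fun w => (\1_B (Y w))%:E * kappa (Z w) A1)
    (fun z => kappa z A2 * (\1_C z)%:E))//.
  - by apply: eq_integral => w _; rewrite !muleA.
  - by apply: emeasurable_funM; exact: mi.
  - apply: emeasurable_funM; first exact: mi.
    exact: measurableT_comp (mk _ mA1) mZ.
  - by move=> w; rewrite fin_numM// pker_fin_num.
  - by move=> D mD; exact: integral_cond_independent.
  - apply: emeasurable_funM; first exact: mk.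
    by apply/measurable_EFinP; exact: measurable_indic.
rewrite half// half//; apply: eq_integral => w _.
by rewrite [kappa _ A * _]muleC.
Qed.

End conditional_exchangeability.

(** * Exchanging the two copies in the data *)

Lemma eq_law_pi_system d d' (T : measurableType d) (S : measurableType d')
    (R : realType) (P : probability T R) (D D' : T -> S) (G : set (set S)) :
  measurable_fun [set: T] D -> measurable_fun [set: T] D' ->
  G `<=` measurable -> setI_closed G -> G setT ->
  (forall A, G A -> P (D @^-1` A) = P (D' @^-1` A)) ->
  forall A, <<s G >> A -> P (D @^-1` A) = P (D' @^-1` A).
Proof.
move=> mD mD' Gm GI GT eqG A sGA.
pose m1 : {measure set S -> \bar R} := pushforward P D.
pose m2 : {measure set S -> \bar R} := pushforward P D'.
apply: (g_sigma_algebra_measure_unique G Gm (fun=> setT) _ _ (m1 mD) (m2 mD'))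
  => //.
- by rewrite bigcup_const.
- by move=> _; rewrite /= /pushforward preimage_setT probability_setT ltry.
Qed.

Section swaps.
Context dX dY dZ (TX : measurableType dX) (TY : measurableType dY)
  (TZ : measurableType dZ) (n : nat).

Let obs := (TX * TX * TY * TZ)%type.

(** As in the definition of the permuted statistic, true keeps the pair and
false exchanges it. *)
Definition swap_obs (b : bool) (v : obs) : obs :=
  if b then v else ((v.1.1.2, v.1.1.1), v.1.2, v.2).

Definition swap_data (pi : {ffun 'I_n -> bool}) (t : n.-tuple obs) :
    n.-tuple obs := [tuple swap_obs (pi i) (tnth t i) | i < n].

Definition box (A A' : 'I_n -> set TX) (B : 'I_n -> set TY)
    (C : 'I_n -> set TZ) : set (n.-tuple obs) :=
  [set t | forall i, (A i `*` A' i `*` B i `*` C i) (tnth t i)].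

Definition boxes : set (set (n.-tuple obs)) :=
  [set E | exists A A' B C, [/\ forall i, measurable (A i),
     forall i, measurable (A' i), forall i, measurable (B i) &
     forall i, measurable (C i)] /\ E = box A A' B C].

Lemma measurable_swap_obs b : measurable_fun [set: obs] (swap_obs b).
Proof.
case: b => /=; first exact: measurable_id.
by do ![apply: measurable_fun_pair => /=];
  do ![exact: measurableT_comp|exact: measurable_snd|apply: measurableT_comp].
Qed.

Lemma measurable_swap_data pi :
  measurable_fun [set: n.-tuple obs] (swap_data pi).
Proof.
apply/measurable_fun_tnthP => i.
rewrite (_ : _ \o _ = swap_obs (pi i) \o (fun t => tnth t i)); last first.
  by apply/funext => t /=; rewrite tnth_mktuple.
by apply: measurableT_comp; [exact: measurable_swap_obs|exact: measurable_tnth].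
Qed.

Lemma boxes_measurable : boxes `<=` measurable.
Proof.
move=> _ [A [A' [B [C [[mA mA' mB mC] ->]]]]].
rewrite (_ : box _ _ _ _ = \bigcap_(i in [set: 'I_n])
    ((fun t => tnth t i) @^-1` (A i `*` A' i `*` B i `*` C i))); last first.
  by apply/seteqP; split => [t tE i _|t tE i]; [exact: tE|exact: (tE i)].
apply: fin_bigcap_measurable => // i _.
rewrite -[X in measurable X]setTI; apply: measurable_tnth => //.
by do 3! apply: measurableX => //.
Qed.

Lemma boxes_setI : setI_closed boxes.
Proof.
move=> _ _ [A [A' [B [C [[mA mA' mB mC] ->]]]]]
  [A1 [A1' [B1 [C1 [[mA1 mA1' mB1 mC1] ->]]]]].
exists (fun i => A i `&` A1 i), (fun i => A' i `&` A1' i),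
  (fun i => B i `&` B1 i), (fun i => C i `&` C1 i).
split; first by split => i; exact: measurableI.
by apply/seteqP; split => [t [h h1] i|t h];
  [have := h i; have := h1 i|split => i; have := h i] => /=; tauto.
Qed.

Lemma boxes_setT : boxes setT.
Proof.
exists (fun=> setT), (fun=> setT), (fun=> setT), (fun=> setT).
by split; [split|apply/seteqP; split].
Qed.

(** Boxes generate the sigma-algebra of the data space because they contain the
preimages of measurable sets under each of the 4n coordinates: these are boxes
that are full in all the other coordinates. *)
Lemma measurable_boxes (E : set (n.-tuple obs)) :
  measurable E -> <<s boxes >> E.
Proof.
suff mid : measurable_fun [set: g_sigma_algebraType boxes]
    (id : g_sigma_algebraType boxes -> n.-tuple obs).
  by move=> mE; have := mid measurableT E mE; rewrite setTI.
apply/measurable_fun_tnthP => i.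
have mbox A A' B C : measurable A -> measurable A' -> measurable B ->
    measurable C -> measurable ((fun t : g_sigma_algebraType boxes => tnth t i)
      @^-1` (A `*` A' `*` B `*` C) : set (g_sigma_algebraType boxes)).
  move=> mA mA' mB mC; apply: sub_sigma_algebra.
  exists (fun j => if j == i then A else setT),
    (fun j => if j == i then A' else setT),
    (fun j => if j == i then B else setT),
    (fun j => if j == i then C else setT).
  split; first by split => j; case: eqP.
  apply/seteqP; split => [t ti j /=|t /(_ i)]; last by rewrite eqxx.
  by have [->|] := eqVneq j i.
apply/measurable_fun_pairP; split; first
  (apply/measurable_fun_pairP; split; first
    (apply/measurable_fun_pairP; split));
  move=> _ A mA; rewrite setTI.
- have := mbox A setT setT setT mA measurableT measurableT measurableT.
  by congr (measurable _); apply/seteqP; split => t /=; tauto.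
- have := mbox setT A setT setT measurableT mA measurableT measurableT.
  by congr (measurable _); apply/seteqP; split => t /=; tauto.
- have := mbox setT setT A setT measurableT measurableT mA measurableT.
  by congr (measurable _); apply/seteqP; split => t /=; tauto.
- have := mbox setT setT setT A measurableT measurableT measurableT mA.
  by congr (measurable _); apply/seteqP; split => t /=; tauto.
Qed.

Lemma swap_data_box pi A A' B C :
  swap_data pi @^-1` box A A' B C =
  box (fun i => if pi i then A i else A' i)
    (fun i => if pi i then A' i else A i) B C.
Proof.
apply/seteqP; split => t h i; have := h i => /=; rewrite tnth_mktuple;
  by case: (pi i) => /=; tauto.
Qed.

End swaps.

(** * Invariance of the law of the data *)

Section swap_invariance.
Context d0 d dX dY dZ (T0 : measurableType d0) (T : measurableType d)
  (TX : measurableType dX) (TY : measurableType dY) (TZ : measurableType dZ)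
  (R : realType) (n : nat).
Variables (P0 : probability T0 R) (X0 : {RV P0 >-> TX}) (Y0 : {RV P0 >-> TY})
  (Z0 : {RV P0 >-> TZ}).
Variable kappa : R.-pker TZ ~> TX.
Hypothesis hkappa : cond_distribution P0 X0 Z0 kappa.
Hypothesis hind : cond_independent P0 X0 Y0 Z0.
Variables (P : probability T R) (X X' : 'I_n -> {RV P >-> TX})
  (Y : 'I_n -> {RV P >-> TY}) (Z : 'I_n -> {RV P >-> TZ}).
Hypothesis hiid : iid_sample P (fun i w => (X i w, Y i w, Z i w))
  P0 (fun w => (X0 w, Y0 w, Z0 w)).
Hypothesis hdraw : drawn_given_sample P (fun i w => (X i w, Y i w, Z i w))
  (fun i w => Z i w) kappa (fun i w => X' i w).

Definition data (w : T) : n.-tuple (TX * TX * TY * TZ)%type :=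
  [tuple (X i w, X' i w, Y i w, Z i w) | i < n].

Lemma measurable_data : measurable_fun [set: T] data.
Proof.
apply/measurable_fun_tnthP => i.
rewrite (_ : _ \o _ = fun w => (X i w, X' i w, Y i w, Z i w)).
  by do 3! apply: measurable_fun_pair => //.
by apply/funext => w /=; rewrite tnth_mktuple.
Qed.

Lemma measurable_cell_weight (A A' : set TX) (B : set TY) (C : set TZ) :
  measurable A -> measurable A' -> measurable B -> measurable C ->
  measurable_fun [set: TX * TY * TZ] (cell_weight kappa A A' B C).
Proof.
move=> mA mA' mB mC; apply: emeasurable_funM.
  exact: measurableT_comp (measurable_kernel kappa _ mA') measurable_snd.
apply/measurable_EFinP; apply: measurable_indic.
by do 2! apply: measurableX => //.
Qed.

Lemma cell_weight01 (A A' : set TX) (B : set TY) (C : set TZ) v :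
  measurable A' -> (0 <= cell_weight kappa A A' B C v <= 1)%E.
Proof.
move=> mA'; have /andP[k0 k1] := pker01 kappa v.2 mA'.
rewrite /cell_weight indicE; case: (_ \in _); first by rewrite mule1 k0.
by rewrite mule0 lexx lee01.
Qed.

(** Conditionally on the sample, the X'_i fall into the A' i with probability
the product of the kappa (Z_i) (A' i); together with the indicators of the
remaining constraints this is a product of functions of the independent
triples. *)
Lemma prob_data_box (A A' : 'I_n -> set TX) (B : 'I_n -> set TY)
    (C : 'I_n -> set TZ) :
  (forall i, measurable (A i)) -> (forall i, measurable (A' i)) ->
  (forall i, measurable (B i)) -> (forall i, measurable (C i)) ->
  (P (data @^-1` box A A' B C) =
   \prod_i \int[P0]_w
     cell_weight kappa (A i) (A' i) (B i) (C i) (X0 w, Y0 w, Z0 w))%E.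
Proof.
move=> mA mA' mB mC.
pose V i w := (X i w, Y i w, Z i w).
have mV i : measurable_fun [set: T] (V i).
  by do 2! apply: measurable_fun_pair => //.
have mV0 : measurable_fun [set: T0] (fun w => (X0 w, Y0 w, Z0 w)).
  by do 2! apply: measurable_fun_pair => //.
pose E := \bigcap_(i in [set: 'I_n]) (V i @^-1` (A i `*` B i `*` C i)).
have mABC i : measurable (A i `*` B i `*` C i).
  by do 2! apply: measurableX => //.
have sE : g_sigma_preimage V E.
  pose W := g_sigma_algebraType
    (\big[setU/set0]_(i < n) preimage_set_system setT (V i) measurable).
  apply: (@fin_bigcap_measurable _ W) => // i _; apply: sub_sigma_algebra => /=.
  rewrite -bigcup_seq/=; exists i => /=; first by rewrite mem_index_enum.
  by exists (A i `*` B i `*` C i) => //; rewrite setTI.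
have mE : measurable E.
  apply: fin_bigcap_measurable => // i _.
  by rewrite -[X in measurable X]setTI; exact: mV.
transitivity (P (E `&` \bigcap_i (X' i @^-1` A' i))).
  congr (P _); apply/seteqP; split => w.
    move=> h; split => i _; have := h i; rewrite tnth_mktuple /V/=; tauto.
  move=> [h h'] i; rewrite tnth_mktuple.
  have := h i I; have := h' i I; rewrite /V/=; tauto.
rewrite (hdraw sE mA') integral_mkcond epatch_indic.
transitivity (\int[P]_w
    \prod_i cell_weight kappa (A i) (A' i) (B i) (C i) (V i w))%E.
  apply: eq_integral => w _ /=; rewrite indicE.
  have [wE|wE] := boolP (w \in E).
    rewrite mule1; apply: eq_bigr => i _; rewrite /cell_weight/= indicE.
    by move: wE; rewrite inE => /(_ i I) wE; rewrite mem_set// mule1.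
  rewrite mule0; move: wE; rewrite notin_setE => wE.
  have [i iE] : exists i, ~ (A i `*` B i `*` C i) (V i w).
    by apply/existsNP => h; apply: wE => i _; exact: h.
  by rewrite (bigD1 i)//= {1}/cell_weight indicE memNset// mule0 mul0e.
rewrite (independent_integral_prod
  (f := fun i => cell_weight kappa (A i) (A' i) (B i) (C i)) mV hiid.1);
  last 2 first.
- by move=> i; exact: measurable_cell_weight.
- by move=> i v; exact: cell_weight01.
apply: eq_bigr => i _.
transitivity (\int[P]_w (cst 1 w *
    cell_weight kappa (A i) (A' i) (B i) (C i) (V i w)))%E.
  by apply: eq_integral => w _; rewrite mul1e.
rewrite (@eq_ge0_integral_weight _ _ _ _ _ _ _ P P0 (V i)
  (fun w => (X0 w, Y0 w, Z0 w)) _ (cst 1%E))//.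
- by apply: eq_integral => w _; rewrite mul1e.
- move=> D mD; rewrite !integral_cst//; last 2 first.
  + by rewrite -[X in measurable X]setTI; exact: mV0.
  + by rewrite -[X in measurable X]setTI; exact: mV.
  by rewrite !mul1e; exact: hiid.2.
- exact: measurable_cell_weight.
- by move=> v; case/andP: (cell_weight01 (A i) (B i) (C i) v (mA' i)).
Qed.

(** Exchanging coordinates of the data amounts to exchanging some of the A i
with A' i, to which each factor of prob_data_box is insensitive. *)
Lemma data_swap_invariant pi (E : set (n.-tuple (TX * TX * TY * TZ)%type)) :
  measurable E ->
  P (data @^-1` E) = P ((swap_data pi \o data) @^-1` E).
Proof.
move=> mE; apply: eq_law_pi_system (measurable_boxes mE).
- exact: measurable_data.
- exact: measurableT_comp (measurable_swap_data _) measurable_data.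
- exact: boxes_measurable.
- exact: boxes_setI.
- exact: boxes_setT.
move=> _ [A [A' [B [C [[mA mA' mB mC] ->]]]]].
transitivity (P (data @^-1` (swap_data pi @^-1` box A A' B C))); last by [].
rewrite swap_data_box !prob_data_box//.
- apply: eq_bigr => i _; case: (pi i) => //.
  by rewrite (integral_cell_weightC hkappa hind).
- by move=> i; case: (pi i).
- by move=> i; case: (pi i).
Qed.

End swap_invariance.

(** * Randomization p-values *)

Section randomization_p_value.
Context d d' (T : measurableType d) (S : measurableType d') (R : realType)
  (I : finType).
Variables (act : I -> S -> S) (op : I -> I -> I) (stat : S -> R).
Hypothesis act_comp : forall i j t, act i (act j t) = act (op j i) t.
Hypothesis op_inj : forall j, injective (op j).
Hypothesis mact : forall i, measurable_fun [set: S] (act i).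
Hypothesis mstat : measurable_fun [set: S] stat.

Definition randomization_p_value (t : S) : R :=
  #|I|%:R^-1 * \sum_i (stat t <= stat (act i t))%R%:R.

(** Among the indices of rank below alpha take the one with the smallest value
of a: all of them are counted in its rank, which is below alpha. *)
Lemma sum_rank_lt (a : I -> R) (alpha : R) : 0 <= alpha ->
  \sum_j ((#|I|%:R^-1 * \sum_k (a j <= a k)%R%:R < alpha)%R%:R : R) <=
  alpha * #|I|%:R.
Proof.
move=> alpha0.
pose J := [pred j | #|I|%:R^-1 * \sum_k (a j <= a k)%R%:R < alpha].
have [j0 Jj0|J0] := pickP J; last first.
  by rewrite big1 ?mulr_ge0// => j _; have := J0 j; rewrite /= => ->.
have [j Jj jmin] := @arg_minP _ _ _ j0 J a Jj0.
have I0 : 0 < #|I|%:R :> R by rewrite ltr0n; apply/card_gt0P; exists j.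
move: (Jj); rewrite /J/= mulrC ltr_pdivrMr// => /ltW; apply: le_trans.
apply: ler_sum => k _; rewrite ler_nat.
case: (boolP (J k)) => [/jmin ->|/negbTE Jk]; first by case: (_ < _).
by rewrite [_ < _]Jk.
Qed.

Lemma measurable_randomization_p_value :
  measurable_fun [set: S] randomization_p_value.
Proof.
apply: measurable_funM => //; apply: measurable_sum => i.
have mb : measurable_fun [set: S] (fun t => stat t <= stat (act i t)).
  by apply: measurable_fun_ler => //; exact: measurableT_comp.
exact: (measurableT_comp (f := fun b : bool => b%:R : R)).
Qed.

(** The p-value of a transformed data set ranks it within the same orbit, so
the whole orbit is compared with one fixed family of values. *)
Lemma randomization_p_value_act t j : randomization_p_value (act j t) =
  #|I|%:R^-1 * \sum_k (stat (act j t) <= stat (act k t))%R%:R.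
Proof.
rewrite /randomization_p_value; congr (_ * _).
rewrite [RHS](reindex_inj (@op_inj j)); apply: eq_bigr => i _.
by rewrite act_comp.
Qed.

(** Averaging P(p < alpha) over the orbit, which invariance of the law allows,
turns it into the expectation of the fraction bounded by sum_rank_lt. *)
Lemma randomization_p_value_superuniform (P : probability T R) (D : T -> S)
    (alpha : R) :
  measurable_fun [set: T] D ->
  (forall i E, measurable E -> P (D @^-1` E) = P ((act i \o D) @^-1` E)) ->
  (0 < #|I|)%N -> 0 <= alpha ->
  (P [set w | (randomization_p_value (D w) < alpha)%R] <= alpha%:E)%E.
Proof.
move=> mD invD I0 alpha0.
pose E := [set t | randomization_p_value t < alpha].
have mE : measurable E.
  have -> : E = [set: S] `&` randomization_p_value @^-1` `]-oo, alpha[%classic.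
    by rewrite setTI; apply/seteqP; split => t /=; rewrite in_itv.
  exact: measurable_randomization_p_value.
have mEi i : measurable ((act i \o D) @^-1` E).
  rewrite -[X in measurable X]setTI.
  by apply: (measurableT_comp (mact i) mD).
have I0R : 0 < #|I|%:R :> R by rewrite ltr0n.
rewrite -(@lee_pmul2l _ #|I|%:R%:E)// ?lte_fin//.
have -> : (#|I|%:R%:E * P [set w | (randomization_p_value (D w) < alpha)%R] =
    \sum_(i : I) P ((act i \o D) @^-1` E))%E.
  rewrite (eq_bigr (fun=> P (D @^-1` E))); last by move=> i _; rewrite -invD.
  have mDE : measurable (D @^-1` E).
    by rewrite -[X in measurable X]setTI; exact: mD.
  rewrite -/(D @^-1` E) -(fineK (fin_num_measure P _ mDE)).
  by rewrite sumEFin sumr_const -[in RHS]mulr_natl -EFinM.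
rewrite -EFinM mulrC.
under eq_bigr do rewrite -[_ @^-1` _]setIT -integral_indic//.
rewrite -ge0_integral_sum//; last first.
  by move=> i; apply/measurable_EFinP; exact: measurable_indic.
apply: (@le_trans _ _ (\int[P]_w (alpha * #|I|%:R)%:E)%E); last first.
  by rewrite integral_cst// [X in (_ * X)%E](probability_setT P) mule1.
apply: ge0_le_integral => //.
- by move=> w _; apply: sume_ge0 => i _; rewrite lee_fin.
- apply: emeasurable_sum => i; apply/measurable_EFinP.
  exact: measurable_indic.
move=> w _; rewrite sumEFin lee_fin.
apply: le_trans (sum_rank_lt (fun i => stat (act i (D w))) alpha0).
apply: ler_sum => i _; rewrite indicE -randomization_p_value_act.
by rewrite ler_nat; case: (boolP (_ \in _)) => //; rewrite inE/= => ->.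
Qed.

End randomization_p_value.

(** * The statistic as a measurable function of the data *)

Section zeta_hat.
Context (R : realType) (sigma : R).

Lemma mixE d b (u v : d.-tuple R) : mix b u v = if b then u else v.
Proof.
apply: eq_from_tnth => k; rewrite tnth_mktuple.
by case: b; rewrite ?subrr ?subr0 ?mul0r ?mul1r ?addr0 ?add0r.
Qed.

Lemma measurable_sum_cond d (T : measurableType d) (I : finType) (Q : pred I)
    (h : I -> T -> R) :
  (forall i, Q i -> measurable_fun [set: T] (h i)) ->
  measurable_fun [set: T] (fun t => \sum_(i | Q i) h i t).
Proof.
move=> mh.
have -> : (fun t => \sum_(i | Q i) h i t) =
    (fun t => \sum_(i : I) if Q i then h i t else 0).
  by apply/funext => t; rewrite big_mkcond.
by apply: measurable_sum => i; case: (boolP (Q i)) => [/mh|_].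
Qed.

Lemma measurable_cat_tuple d (T : measurableType d) m n
    (u : T -> m.-tuple R) (v : T -> n.-tuple R) :
  measurable_fun [set: T] u -> measurable_fun [set: T] v ->
  measurable_fun [set: T] (fun t => [tuple of u t ++ v t]).
Proof.
move=> mu mv; apply/measurable_fun_tnthP => i.
case: (split_ordP i) => j ->.
- rewrite (_ : _ \o _ = (fun t => tnth (u t) j)).
    exact: measurableT_comp (measurable_tnth j) mu.
  by apply/funext => t /=; rewrite tnth_lshift.
- rewrite (_ : _ \o _ = (fun t => tnth (v t) j)).
    exact: measurableT_comp (measurable_tnth j) mv.
  by apply/funext => t /=; rewrite tnth_rshift.
Qed.

Lemma measurable_gauss_kernel d (T : measurableType d) m
    (u v : T -> m.-tuple R) :
  measurable_fun [set: T] u -> measurable_fun [set: T] v ->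
  measurable_fun [set: T] (fun t => gauss_kernel sigma (u t) (v t)).
Proof.
move=> mu mv; apply: measurableT_comp => //.
apply: measurableT_comp => //; apply: measurable_funM => //.
apply: measurable_funM => //; apply: measurable_sum => k.
apply: measurable_funX; apply: measurable_funB.
  exact: measurableT_comp (measurable_tnth k) mu.
exact: measurableT_comp (measurable_tnth k) mv.
Qed.

Context (dX dY dZ n : nat).
Let obs := (dX.-tuple R * dX.-tuple R * dY.-tuple R * dZ.-tuple R)%type.

Lemma eq_zeta_hat (x1 x2 x1' x2' : 'I_n -> dX.-tuple R)
    (y1 y2 : 'I_n -> dY.-tuple R) (z1 z2 : 'I_n -> dZ.-tuple R) :
  x1 =1 x2 -> x1' =1 x2' -> y1 =1 y2 -> z1 =1 z2 ->
  zeta_hat sigma x1 x1' y1 z1 = zeta_hat sigma x2 x2' y2 z2.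
Proof. by move=> /funext-> /funext-> /funext-> /funext->. Qed.

Definition zeta_stat (t : n.-tuple obs) : R :=
  zeta_hat sigma (fun i => (tnth t i).1.1.1) (fun i => (tnth t i).1.1.2)
    (fun i => (tnth t i).1.2) (fun i => (tnth t i).2).

Lemma measurable_zeta_stat : measurable_fun [set: n.-tuple obs] zeta_stat.
Proof.
have mt i : measurable_fun [set: n.-tuple obs] (fun t => tnth t i).
  exact: measurable_tnth.
have m3 i : measurable_fun [set: n.-tuple obs] (fun t => (tnth t i).2).
  exact: measurableT_comp measurable_snd (mt i).
have m12 i : measurable_fun [set: n.-tuple obs] (fun t => (tnth t i).1).
  exact: measurableT_comp measurable_fst (mt i).
have m2 i : measurable_fun [set: n.-tuple obs] (fun t => (tnth t i).1.2).
  exact: measurableT_comp measurable_snd (m12 i).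
have m11 i : measurable_fun [set: n.-tuple obs] (fun t => (tnth t i).1.1).
  exact: measurableT_comp measurable_fst (m12 i).
have m1 i : measurable_fun [set: n.-tuple obs] (fun t => (tnth t i).1.1.1).
  exact: measurableT_comp measurable_fst (m11 i).
have m1' i : measurable_fun [set: n.-tuple obs] (fun t => (tnth t i).1.1.2).
  exact: measurableT_comp measurable_snd (m11 i).
rewrite /zeta_stat /zeta_hat; apply: measurable_funM => //.
apply: measurable_sum => i.
apply: measurable_sum_cond => j _.
have mv k : measurable_fun [set: n.-tuple obs] (fun t =>
    [tuple of (tnth t k).1.1.1 ++ (tnth t k).1.2 ++ (tnth t k).2]).
  by apply: measurable_cat_tuple => //; exact: measurable_cat_tuple.
have mv' k : measurable_fun [set: n.-tuple obs] (fun t =>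
    [tuple of (tnth t k).1.1.2 ++ (tnth t k).1.2 ++ (tnth t k).2]).
  by apply: measurable_cat_tuple => //; exact: measurable_cat_tuple.
apply: measurable_funB; [apply: measurable_funB; [apply: measurable_funD|]|].
- exact: measurable_gauss_kernel (mv i) (mv j).
- exact: measurable_gauss_kernel (mv' i) (mv' j).
- exact: measurable_gauss_kernel (mv i) (mv' j).
- exact: measurable_gauss_kernel (mv' i) (mv j).
Qed.

End zeta_hat.

Theorem proposition2p6 (R : realType) (sigma : R) (dX dY dZ n : nat)
  (hsigma : 0 < sigma ^+ 2) (hn : (2 <= n)%N)
  (* the generic vector (X, Y, Z), whose law is the unknown P *)
  (d0 : measure_display) (T0 : measurableType d0) (P0 : probability T0 R)
  (X0 : {RV P0 >-> dX.-tuple R}) (Y0 : {RV P0 >-> dY.-tuple R})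
  (Z0 : {RV P0 >-> dZ.-tuple R})
  (* the conditional distribution of X given Z *)
  (kappa : R.-pker (dZ.-tuple R) ~> (dX.-tuple R))
  (hkappa : cond_distribution P0 X0 Z0 kappa)
  (* the augmented data *)
  (d : measure_display) (T : measurableType d) (P : probability T R)
  (X X' : 'I_n -> {RV P >-> dX.-tuple R})
  (Y : 'I_n -> {RV P >-> dY.-tuple R})
  (Z : 'I_n -> {RV P >-> dZ.-tuple R})
  (hiid : iid_sample P (fun i w => (X i w, Y i w, Z i w))
            P0 (fun w => (X0 w, Y0 w, Z0 w)))
  (hdraw : drawn_given_sample P (fun i w => (X i w, Y i w, Z i w))
             (fun i w => Z i w) kappa (fun i w => X' i w))
  (* the null hypothesis *)
  (H0 : cond_independent P0 X0 Y0 Z0)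
  (alpha : R) (halpha : 0 < alpha < 1) :
  (P [set w | (p_value sigma (fun i => X i w) (fun i => X' i w)
                (fun i => Y i w) (fun i => Z i w) < alpha)%R] <= alpha%:E)%E.
Proof.
have /andP[alpha0 _] := halpha.
pose D : T -> n.-tuple _ := data X X' Y Z.
have stat_swap pi w : zeta_hat_swap sigma (fun i => X i w) (fun i => X' i w)
    (fun i => Y i w) (fun i => Z i w) pi = zeta_stat sigma (swap_data pi (D w)).
  by apply: eq_zeta_hat => i; rewrite !tnth_mktuple ?mixE; case: (pi i).
have stat w : zeta_hat sigma (fun i => X i w) (fun i => X' i w)
    (fun i => Y i w) (fun i => Z i w) = zeta_stat sigma (D w).
  by apply: eq_zeta_hat => i; rewrite tnth_mktuple.
rewrite (_ : [set w | _] = [set w | randomization_p_value (@swap_data _ _ _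
    (dX.-tuple R) (dY.-tuple R) (dZ.-tuple R) n)
    (@zeta_stat R sigma dX dY dZ n) (D w) < alpha]); last first.
  apply/funext => w /=; congr (is_true (_ < _)); rewrite /p_value stat.
  rewrite /randomization_p_value card_ffun card_bool card_ord natrX.
  by congr (_ * _); apply: eq_bigr => pi _; rewrite stat_swap.
(* The composition of two exchange patterns exchanges where they differ, so it
   keeps the pair exactly where they agree. *)
apply: (randomization_p_value_superuniform
  (op := fun pi rho : {ffun 'I_n -> bool} => [ffun i => pi i == rho i])).
- move=> pi rho t; apply: eq_from_tnth => i; rewrite !tnth_mktuple ffunE.
  by case: (pi i); case: (rho i); case: (tnth t i) => [[[]]].
- move=> pi rho rho' /ffunP eqr; apply/ffunP => i.
  by have := eqr i; rewrite !ffunE; case: (pi i) (rho i) (rho' i) => [] [] [].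
- exact: measurable_swap_data.
- exact: measurable_zeta_stat.
- exact: measurable_data.
- by move=> pi E mE; exact: (data_swap_invariant hkappa H0 hiid hdraw).
- by rewrite card_ffun expn_gt0 card_bool.
- exact: ltW.
Qed.
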